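(* For each pair of positive integers $d,r$, there are only finitely many totally real number fields $K$ of degree $d=[K:\mathbb{Q}]$ such that there is a positive definite quadratic form over $\mathbb{Z}$ of rank $r$ that is universal over $K$.
   Context: Number fields are considered inside a fixed algebraic closure of $\mathbb{Q}$. A quadratic form over $\mathbb{Z}$ of rank $r$ is a form $Q(x_1,\dots,x_r)=\sum_{1\le i\le j\le r}a_{ij}x_ix_j$ with $a_{ij}\in\mathbb{Z}$ (the off-diagonal coefficients are not required to be even). For a totally real number field $K$ with ring of integers $\mathcal{O}_K$, an element $\alpha\in K$ is totally positive if $\sigma(\alpha)>0$ for every embedding $\sigma:K\hookrightarrow\mathbb{R}$; $\mathcal{O}_K^+$ is the set of totally positive elements of $\mathcal{O}_K$. Such a form $Q$ is universal over $K$ if for every $\alpha\in\mathcal{O}_K^+$ there is $v\in\mathcal{O}_K^r$ with $Q(v)=\alpha$. *)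

(* Defs.v *)
From HB Require Import structures.
From mathcomp Require Import all_boot all_order all_algebra all_field.
From mathcomp Require Import boolp classical_sets cardinality.

Set Implicit Arguments.
Unset Strict Implicit.
Unset Printing Implicit Defensive.

Import Order.TTheory GRing.Theory Num.Theory.

Local Open Scope ring_scope.
Local Open Scope classical_set_scope.

(* A number field is an L : fieldExtType rat (finite over rat by definition,
   of degree \dim {:L}). The fixed algebraic closure of the rationals is algC.
   Elements of L are algebraic, so an embedding of L into the complex numbers
   takes its values in algC, and an embedding into the real numbers is an
   embedding into algC all of whose values are real. *)
Definition real_embedding (L : fieldExtType rat)
    (sigma : {rmorphism L -> algC}) : Prop :=
  forall x : L, sigma x \is Num.real.

Definition totally_real (L : fieldExtType rat) : Prop :=
  forall sigma : {rmorphism L -> algC}, real_embedding sigma.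

Definition totally_positive (L : fieldExtType rat) (alpha : L) : Prop :=
  forall sigma : {rmorphism L -> algC}, real_embedding sigma -> 0 < sigma alpha.

Definition ring_of_integers (L : fieldExtType rat) : set L :=
  [set x : L | integralOver (intr : int -> L) x].
Arguments ring_of_integers : clear implicits.

(* The form with coefficients a_ij, i <= j. The matrix a is not the Gram matrix:
   its entries strictly below the diagonal are ignored. *)
Definition qform_eval (r : nat) (a : 'M[int]_r) (R : comNzRingType)
    (x : 'rV[R]_r) : R :=
  \sum_(i < r) \sum_(j < r | (i <= j)%N) (a i j)%:~R * x 0 i * x 0 j.

Definition positive_definite (r : nat) (a : 'M[int]_r) : Prop :=
  forall x : 'rV[int]_r, x != 0 -> 0 < qform_eval a x.

Definition universal_over (r : nat) (a : 'M[int]_r) (L : fieldExtType rat)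
    : Prop :=
  forall alpha : L, ring_of_integers L alpha -> totally_positive alpha ->
  exists v : 'rV[L]_r,
    (forall i, ring_of_integers L (v 0 i)) /\ qform_eval a v = alpha.

(* Isomorphic copies of L that are distinct as subfields of algC are counted
   separately. *)
Definition number_subfield (L : fieldExtType rat)
    (iota : {rmorphism L -> algC}) : set algC :=
  range iota.

(* Main.v *)
Require Import Defs.
From HB Require Import structures.
From mathcomp Require Import all_boot all_order all_algebra all_field.
From mathcomp Require Import boolp classical_sets cardinality.
From mathcomp Require Import zify ring lra.

Set Implicit Arguments.
Unset Strict Implicit.
Unset Printing Implicit Defensive.

Import Order.TTheory GRing.Theory Num.Theory.

Local Open Scope ring_scope.
Local Open Scope classical_set_scope.

(** Every positive definite integral form of rank [r], whatever its
    coefficients, becomes after a unimodular change of variables so round that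
    [\sum_i x_i ^+ 2 <= N * Q x] on real vectors, where [N] depends on [r]
    alone ([hermite_reduction]). The point is that [Q] takes integral values,
    so that its minimum on nonzero integral vectors is at least 1 and cannot
    degenerate; Hermite's induction then controls the remaining directions.

    Let [Q] be universal over a totally real [L] of degree [d], and reduced in
    this way. The house of an integer of [L] is the largest of its absolute
    values under the embeddings of [L]. An integer [x] of house at most [B] gives
    the totally positive integer [x + (B + 1)], of house at most [2 * B + 1].
    By universality this is [Q w] for some integral [w], and the inequality
    above, applied in each embedding, bounds the house of the coordinates of [w]
    by the square root of [N * (2 * B + 1)]. This is at most [B - 1] as soon as
    [B] exceeds a constant [C] that depends on [r] alone, so descent on [B] writes every integer of [L] as a polynomial expression in integers of
    house at most [C] ([integers_from_small_house]).

    Hence [L], seen inside [algC], is generated by those of its integers whose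
    house is at most [C]. Their degree is at most [d], so by Northcott's
    theorem ([northcott]) they all lie in a finite set that depends on [d] and
    [r] only. A finite set has finitely many subsets, and each generates one
    field. *)

(** * Values of integral quadratic and linear forms *)

(** No shape is imposed on [A]: triangular matrices are not stable under the
    change of variables [U *m A *m U^T], and the symmetric matrix of an integral
    form need not be integral. *)
Definition qval (R : comNzRingType) n (A : 'M[int]_n) (x : 'rV[R]_n) : R :=
  (x *m map_mx intr A *m x^T) 0 0.

Definition lval (R : comNzRingType) n (l : 'rV[int]_n) (x : 'rV[R]_n) : R :=
  (x *m (map_mx intr l)^T) 0 0.

Definition sumsq (R : comNzRingType) n (x : 'rV[R]_n) : R :=
  \sum_(i < n) x 0 i ^+ 2.

Lemma qform_eval_qval r (a : 'M[int]_r) (R : comNzRingType) (x : 'rV[R]_r) :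
  qform_eval a x = qval (\matrix_(i, j) (a i j *+ (i <= j)%N)) x.
Proof.
under [LHS]eq_bigr do rewrite big_mkcond /=.
rewrite exchange_big /qval mxE; apply: eq_bigr => j _ /=.
rewrite !mxE mulr_suml; apply: eq_bigr => i _.
by rewrite !mxE; case: (i <= j)%N; rewrite ?mulr1n ?mulr0n ?mulr0 ?mul0r ?[x 0 i * _]mulrC.
Qed.

Lemma qval_mul (R : comNzRingType) n (A U : 'M[int]_n) (x : 'rV[R]_n) :
  qval A (x *m map_mx intr U) = qval (U *m A *m U^T) x.
Proof. by rewrite /qval !map_mxM /= trmx_mul -map_trmx !mulmxA. Qed.

Lemma map_mx_intr_rmorph (R S : comNzRingType) (f : {rmorphism R -> S}) m n
    (A : 'M[int]_(m, n)) :
  map_mx f (map_mx intr A) = map_mx intr A :> 'M[S]_(m, n).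
Proof. by apply/matrixP => i j; rewrite !mxE rmorph_int. Qed.

Lemma qval_rmorph (R S : comNzRingType) (f : {rmorphism R -> S}) n
    (A : 'M[int]_n) (x : 'rV[R]_n) :
  f (qval A x) = qval A (map_mx f x).
Proof.
by rewrite /qval -(map_mx_intr_rmorph f) map_trmx -!map_mxM [in RHS]mxE.
Qed.

Lemma lval_sum (R : comNzRingType) n (l : 'rV[int]_n) (x : 'rV[R]_n) :
  lval l x = \sum_j (l 0 j)%:~R * x 0 j.
Proof. by rewrite /lval mxE; apply: eq_bigr => j _; rewrite !mxE mulrC. Qed.

Lemma lval_mul (R : comNzRingType) n (l : 'rV[int]_n) U (x : 'rV[R]_n) :
  lval l (x *m map_mx intr U) = lval (l *m U^T) x.
Proof. by rewrite /lval map_mxM /= trmx_mul -map_trmx trmxK mulmxA. Qed.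

Lemma lval_sqr (R : comNzRingType) n (l : 'rV[int]_n) (x : 'rV[R]_n) :
  lval l x ^+ 2 = qval (l^T *m l) x.
Proof.
have E : x *m map_mx intr (l^T *m l) *m x^T
    = (x *m (map_mx intr l)^T) *m (x *m (map_mx intr l)^T)^T.
  by rewrite map_mxM /= trmx_mul trmxK map_trmx !mulmxA.
by rewrite /qval E mxE big_ord1 [X in _ * X]mxE -expr2.
Qed.

(** * Completing the square *)

(** At a vector [(y, x)] the form is [a * y ^+ 2 + y * l x + Q' x], where
    [a := A 0 0] and [l := linear_part A]. Multiplication by [4 * a] completes
    the square in [y] without leaving the integers: what remains beside
    [(2 * a * y + l x) ^+ 2] is the form of [schur_part A]. *)
Definition linear_part n (A : 'M[int]_(1 + n)) : 'rV[int]_n :=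
  ursubmx A + (dlsubmx A)^T.

Definition schur_part n (A : 'M[int]_(1 + n)) : 'M[int]_n :=
  (4 * A 0 0) *: drsubmx A - (linear_part A)^T *m linear_part A.

Lemma complete_square (R : comNzRingType) n (A : 'M[int]_(1 + n))
    (y : R) (x : 'rV[R]_n) :
  4 * (A 0 0)%:~R * qval A (row_mx y%:M x)
  = (2 * (A 0 0)%:~R * y + lval (linear_part A) x) ^+ 2 + qval (schur_part A) x.
Proof.
have qB (c : int) (B : 'M[int]_n) (l : 'rV[int]_n) :
    qval (c *: B - l^T *m l) x = c%:~R * qval B x - lval l x ^+ 2.
  rewrite lval_sqr /qval map_mxB map_mxZ mulmxBr mulmxBl -scalemxAr -scalemxAl.
  by rewrite !mxE.
rewrite qB.
have -> : qval A (row_mx y%:M x)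
   = (A 0 0)%:~R * y ^+ 2 + y * lval (linear_part A) x + qval (drsubmx A) x.
  have lD : lval (linear_part A) x = lval (ursubmx A) x + lval (dlsubmx A)^T x.
    by rewrite /lval map_mxD linearD mulmxDr mxE.
  have A00 : (ulsubmx A) 0 0 = A 0 0 by rewrite !mxE; congr (A _ _); apply/val_inj.
  have ur : (map_mx intr (ursubmx A) *m x^T) = (lval (ursubmx A) x)%:M.
    by rewrite [LHS]mx11_scalar /lval -[x *m _]trmxK trmx_mul trmxK [in RHS]mxE.
  have dl : (x *m map_mx intr (dlsubmx A)) = (lval (dlsubmx A)^T x)%:M.
    by rewrite [LHS]mx11_scalar /lval map_trmx trmxK.
  have ul : map_mx intr (ulsubmx A) = ((A 0 0)%:~R : R)%:M.
    by rewrite [LHS]mx11_scalar mxE A00.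
  rewrite lD /qval -{1}[A]submxK map_block_mx mul_row_block tr_row_mx mul_row_col.
  rewrite ul dl tr_scalar_mx !mulmxDl -[_ *m _ *m x^T]mulmxA ur -!scalar_mxM -!raddfD /=.
  by rewrite [LHS]mxE [X in X + _]mxE [X in _ + X]mxE [X in _ + (X + _)]mxE
     eqxx !mulr1n; ring.
rewrite intrM; ring.
Qed.

Lemma qvalZ (R : comNzRingType) n (A : 'M[int]_n) (c : R) (x : 'rV[R]_n) :
  qval A (c *: x) = c ^+ 2 * qval A x.
Proof. by rewrite /qval linearZ /= -!scalemxAl -scalemxAr !mxE; ring. Qed.

Lemma intr_mx_int m n (U : 'M[int]_(m, n)) : map_mx intr U = U.
Proof. by apply/matrixP => i j; rewrite mxE intz. Qed.

Lemma qval_delta n (A : 'M[int]_n) i : qval A (delta_mx 0 i) = A i i.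
Proof. by rewrite /qval intr_mx_int trmx_delta -rowE -colE !mxE. Qed.

(** * Hermite reduction *)

(** A minimal vector is primitive, hence the first vector of a basis. Here
    primitivity comes for free: the Smith normal form shows that a minimal [b]
    is an integral multiple of a basis vector, whose value is no larger. *)
Lemma minimal_basis_vector n (A : 'M[int]_(1 + n)) :
    (forall x : 'rV[int]_(1 + n), x != 0 -> 0 < qval A x) ->
  exists2 V : 'M[int]_(1 + n), V \in unitmx &
    forall x : 'rV[int]_(1 + n), x != 0 -> (V *m A *m V^T) 0 0 <= qval A x.
Proof.
move=> Apos.
pose P k := `[< exists2 x : 'rV[int]_(1 + n), x != 0 & qval A x = k%:Z >].
have exP (x : 'rV[int]_(1 + n)) : x != 0 -> P `|qval A x|%N.
  by move=> x0; apply/asboolP; exists x => //; rewrite gez0_abs // ltW ?Apos.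
have : exists k, P k.
  exists `|qval A (const_mx 1%R)|%N; apply: exP.
  by apply/eqP => /matrixP/(_ 0 0); rewrite !mxE.
move=> /ex_minnP[k /asboolP[b b0 qb] kmin].
have {kmin} bmin (x : 'rV[int]_(1 + n)) : x != 0 -> qval A b <= qval A x.
  move=> x0; have := kmin _ (exP x x0).
  by rewrite qb -lez_nat gez0_abs // ltW ?Apos.
have [L Lu [V Vu [d _ bE]]] := int_Smith_normal_form b.
have [c bcV] : exists c : int, b = c *: row 0 V.
  exists (L 0 0 * d`_0); rewrite bE [L]mx11_scalar -mulmxA mul_scalar_mx -scalerA.
  rewrite mxE eqxx mulr1n; congr (_ *: _).
  apply/rowP => j; rewrite !mxE (bigD1 0) //= !mxE big1 ?addr0 // => i i0.
  by rewrite mxE eq_sym -val_eqE /= in i0 *; rewrite (negPf i0) mul0r.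
have diagE : (V *m A *m V^T) 0 0 = qval A (row 0 V).
  by rewrite -qval_delta -qval_mul intr_mx_int rowE.
exists V => // x x0; apply: le_trans (bmin x x0).
have c0 : c != 0 by apply: contraNneq b0 => c0; rewrite bcV c0 scale0r.
have row0 : row 0 V != 0 by apply: contraNneq b0 => V0; rewrite bcV V0 scaler0.
rewrite diagE bcV qvalZ ler_peMl ?(ltW (Apos _ row0)) //.
by rewrite -gtz0_ge1 lt_def sqrf_eq0 c0 sqr_ge0.
Qed.

(** Any integral [x] extends to a vector [(y, x)] for which the completed square
    has root of absolute value at most [A 0 0]: choose [y] by centred Euclidean
    division by [2 * A 0 0]. The value there is at least the minimum [A 0 0], so
    [4 * A 0 0 ^+ 2 <= A 0 0 ^+ 2 + qval (schur_part A) x]. *)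
Lemma schur_part_ge n (A : 'M[int]_(1 + n)) :
    0 < A 0 0 -> (forall x : 'rV[int]_(1 + n), x != 0 -> A 0 0 <= qval A x) ->
  forall x : 'rV[int]_n, x != 0 -> 3 * A 0 0 ^+ 2 <= qval (schur_part A) x.
Proof.
move=> a0 Amin x x0; set a := A 0 0 in a0 Amin *; set t := lval (linear_part A) x.
pose y := - ((t + a) %/ (2 * a))%Z; pose s := ((t + a) %% (2 * a))%Z.
have ds : 2 * a * y + t = s - a.
  by have := divz_eq (t + a) (2 * a); rewrite -/s /y; lra.
have s0 : 0 <= s by apply: modz_ge0; lia.
have s1 : s < 2 * a by apply: ltz_pmod; lia.
have z0 : row_mx y%:M x != 0.
  by apply: contraNneq x0 => z0; rewrite -[x](row_mxKr y%:M) z0 linear0.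
have sq := complete_square A y x; rewrite -/a !intz -/t ds in sq.
have Q1 : 4 * a * a <= 4 * a * qval A (row_mx y%:M x).
  by rewrite ler_wpM2l ?Amin //; lia.
have s2 : 0 <= s * (2 * a - s) by rewrite mulr_ge0 //; lia.
clearbody s; move: (qval A _) (qval (schur_part A) x) sq Q1 s2 => q D.
clear -a0; clearbody a; move=> sq Q1 s2; lia.
Qed.

Lemma sqr_sum_le (R : realDomainType) n (f : 'I_n -> R) :
  (\sum_i f i) ^+ 2 <= n%:R * \sum_i f i ^+ 2.
Proof.
have -> : n%:R * \sum_i f i ^+ 2 = \sum_(i < n) \sum_(j < n) f j ^+ 2.
  by rewrite sumr_const card_ord mulr_natl.
rewrite -(ler_pM2l (ltr0Sn R 1)) expr2 mulr_suml mulr_sumr.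
have E : 2 * \sum_(i < n) \sum_(j < n) f j ^+ 2
    = \sum_(i < n) \sum_(j < n) (f i ^+ 2 + f j ^+ 2).
  rewrite mulr_natl mulr2n {1}exchange_big -big_split; apply: eq_bigr => i _.
  by rewrite -big_split.
rewrite E; apply: ler_sum => i _; rewrite mulrA mulr_sumr; apply: ler_sum => j _.
have := sqr_ge0 (f i - f j); lra.
Qed.

Lemma lval_sqr_le (R : realDomainType) n (l : 'rV[int]_n) (a : int)
    (x : 'rV[R]_n) :
    (forall j, 0 <= l 0 j <= a) ->
  lval l x ^+ 2 <= n%:R * a%:~R ^+ 2 * sumsq x.
Proof.
move=> la; rewrite lval_sum (le_trans (sqr_sum_le _)) // -mulrA ler_wpM2l //.
rewrite /sumsq mulr_sumr ler_sum // => j _; rewrite exprMn ler_wpM2r ?sqr_ge0 //.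
have /andP[l0 l1] := la j.
by rewrite lerXn2r ?nnegrE ?ler0z ?ler_int // (le_trans l0).
Qed.

Lemma sumsq_row_mx (R : comNzRingType) n (y : R) (x : 'rV[R]_n) :
  sumsq (row_mx y%:M x) = y ^+ 2 + sumsq x.
Proof.
rewrite /sumsq big_split_ord big_ord1 row_mxEl mxE eqxx mulr1n; congr (_ + _).
by apply: eq_bigr => i _; rewrite row_mxEr.
Qed.

Lemma sumsq_ge0 (R : realDomainType) n (x : 'rV[R]_n) : 0 <= sumsq x.
Proof. by apply: sumr_ge0 => i _; apply: sqr_ge0. Qed.

(** The shear by [k] leaves the first basis vector alone and changes the linear
    part of the completed square by multiples of [2 * A 0 0]. *)
Lemma mul_row_shear (R : comNzRingType) n (U : 'M[int]_n) (k : 'cV[int]_n)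
    (y : R) (x : 'rV[R]_n) :
  row_mx y%:M x *m map_mx intr (block_mx 1%:M 0 k U)
  = row_mx (y + lval k^T x)%:M (x *m map_mx intr U).
Proof.
rewrite map_block_mx mul_row_block map_mx1 map_mx0 mulmx1 mulmx0 add0r.
congr row_mx; rewrite raddfD /=; congr (_ + _).
by rewrite [LHS]mx11_scalar /lval map_trmx trmxK.
Qed.

(** The inequality behind the inductive step: [b] is the minimum, [Q] the value of
    the form, [D] that of the Schur part, [T] that of the reduced linear part
    and [S] the sum of the squares of all coordinates but [y]. Bound
    [(2 * b * y) ^+ 2] by [2 * (2 * b * y + T) ^+ 2 + 2 * T ^+ 2], then absorb
    [T ^+ 2] and [S] into [D]. *)
Lemma hermite_step_bound (R : realDomainType) (T Q D S b y n N : R) :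
    0 <= n -> 0 < N -> 0 <= S -> 0 < b ->
    3 * (b * b) * S <= N * D -> T ^+ 2 <= n * (2 * b) ^+ 2 * S ->
    4 * b * Q = (2 * b * y + T) ^+ 2 + D ->
  4 * b * (b * (y ^+ 2 + S)) <= 4 * b * ((2 + (8 * n + 4) * N) * Q).
Proof.
move=> n0 N0 S0 b0 HD HT sq.
have ND0 : 0 <= N * D by apply: le_trans HD; rewrite mulr_ge0 ?mulr_ge0 ?sqr_ge0; lra.
have D0 : 0 <= D by rewrite pmulr_rge0 in ND0.
have D1 : (8 * n + 4) * (3 * (b * b) * S) <= (8 * n + 4) * (N * D).
  by rewrite ler_wpM2l //; lra.
have D2 : 0 <= (8 * n + 4) * (N * D) by rewrite mulr_ge0 //; lra.
have D3 : 0 <= N * (8 * n + 4) * (2 * b * y + T) ^+ 2.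
  by rewrite mulr_ge0 ?sqr_ge0 ?mulr_ge0 //; lra.
have D4 : 4 * b ^+ 2 * y ^+ 2 <= 2 * (2 * b * y + T) ^+ 2 + 2 * T ^+ 2.
  by have := sqr_ge0 (2 * b * y + 2 * T); lra.
have -> : 4 * b * ((2 + (8 * n + 4) * N) * Q) = (2 + (8 * n + 4) * N) * (4 * b * Q).
  by ring.
rewrite sq; lra.
Qed.

(** The lower bound [m] is kept as a parameter because the induction passes to
    the Schur part, whose minimum is at least three times the square of that of
    [A] by [schur_part_ge]. *)
Theorem hermite_reduction n : exists2 N : nat, (0 < N)%N &
  forall (A : 'M[int]_n) (m : int), 0 < m ->
    (forall x : 'rV[int]_n, x != 0 -> m <= qval A x) ->
  exists2 U : 'M[int]_n, U \in unitmx &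
    forall (R : realDomainType) (x : 'rV[R]_n),
      m%:~R * sumsq x <= N%:R * qval A (x *m map_mx intr U).
Proof.
elim: n => [|n [N N0 IH]].
  exists 1%N => // A m _ _; exists 1%:M; first exact: unitmx1.
  by move=> R x; rewrite /sumsq big_ord0 mulr0 mul1r /qval mxE big_ord0.
exists (2 + (8 * n + 4) * N)%N => // A m m0 Amin.
have [|V Vu Vmin] := @minimal_basis_vector n A.
  by move=> x /Amin; apply: lt_le_trans.
pose B : 'M[int]_(1 + n) := V *m A *m V^T.
have Bmin (x : 'rV[int]_(1 + n)) : x != 0 -> B 0 0 <= qval B x.
  move=> x0; rewrite /B -qval_mul intr_mx_int; apply: Vmin.
  by apply: contraNneq x0 => xV; rewrite -[x](mulmxK Vu) xV mul0mx.
have mB : m <= B 0 0.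
  rewrite -[B 0 0]qval_delta -qval_mul intr_mx_int; apply: Amin.
  apply/eqP => /(congr1 (mulmx^~ (invmx V))); rewrite mulmxK // mul0mx.
  by move/matrixP/(_ 0 0); rewrite !mxE.
set b := B 0 0 in Bmin mB.
have b0 : 0 < b by apply: lt_le_trans mB.
have [U Uu HU] := IH (schur_part B) (3 * b ^+ 2) ltac:(nia)
  (schur_part_ge b0 Bmin).
(* The coefficients of the linear part are reduced modulo twice the minimum. *)
pose l := linear_part B *m U^T.
pose k : 'cV[int]_n := \col_j - divz (l 0 j) (2 * b).
pose t : 'rV[int]_n := \row_j modz (l 0 j) (2 * b).
have tE : (2 * b) *: k^T + l = t.
  by apply/rowP => j; rewrite !mxE [X in _ + X](divz_eq _ (2 * b)); ring.
exists (block_mx 1%:M 0 k U *m V).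
  by rewrite unitmx_mul Vu andbT unitmxE (det_lblock 1%:M k U) det1 mul1r -unitmxE.
move=> R x; rewrite map_mxM mulmxA (qval_mul A V) -/B.
have -> : x = row_mx (lsubmx (x : 'rV_(1 + n)) 0 0)%:M (rsubmx (x : 'rV_(1 + n))).
  by rewrite -mx11_scalar hsubmxK.
move: (lsubmx _ _ _) (rsubmx _) => y {}x.
rewrite mul_row_shear sumsq_row_mx.
set Q := qval B _; set S := sumsq x.
have sq : 4 * b%:~R * Q = (2 * b%:~R * y + lval t x) ^+ 2
     + qval (schur_part B) (x *m map_mx intr U).
  rewrite /Q complete_square lval_mul -/l -/b; congr (_ ^+ 2 + _).
  rewrite -tE /lval map_mxD map_mxZ raddfD /= linearZ mulmxDr -scalemxAr [in RHS]mxE.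
  by rewrite [X in _ = _ + (X + _)]mxE intrM; ring.
have HD := HU R x; set D := qval (schur_part B) _ in sq HD.
have Ht : lval t x ^+ 2 <= n%:R * (2 * b)%:~R ^+ 2 * S.
  apply: lval_sqr_le => j; rewrite mxE modz_ge0 ?ltW ?ltz_pmod //; lia.
have S0 : 0 <= S := sumsq_ge0 x.
have mb : m%:~R <= b%:~R :> R by rewrite ler_int.
have bR : 0 < b%:~R :> R by rewrite ltr0z.
have : m%:~R * (y ^+ 2 + S) <= b%:~R * (y ^+ 2 + S).
  by rewrite ler_wpM2r // addr_ge0 // sqr_ge0.
move=> /le_trans; apply.
rewrite -(ler_pM2l (_ : 0 < 4 * b%:~R)); last by rewrite mulr_gt0.
have NR : 0 < N%:R :> R by rewrite ltr0n.
rewrite !intrM in HD Ht; rewrite natrD natrM natrD natrM.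
exact: (hermite_step_bound (ler0n _ _) NR S0 bR HD Ht sq).
Qed.

(** * Descent on the house *)

(** Reality of the coordinates lets the inequality be read in the ordered field
    of real algebraic numbers. *)
Lemma reduced_coord_le n (A : 'M[int]_n) (U : 'M[int]_n) (N : nat) :
    (forall (R : realDomainType) (x : 'rV[R]_n),
      sumsq x <= N%:R * qval A (x *m map_mx intr U)) ->
  forall (x : 'rV[algC]_n), (forall i, x 0 i \is Num.real) ->
  forall i, x 0 i ^+ 2 <= N%:R * qval A (x *m map_mx intr U).
Proof.
move=> HU x xr i.
pose y : 'rV[algR]_n := \row_i in_algR (xr i).
have xE : x = map_mx algRval y by apply/rowP => j; rewrite !mxE.
rewrite {2}xE -(map_mx_intr_rmorph algRval) -map_mxM -qval_rmorph.
have : y 0 i ^+ 2 <= N%:R * qval A (y *m map_mx intr U).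
  apply: le_trans (HU _ y); rewrite /sumsq (bigD1 i) //= lerDl.
  by apply: sumr_ge0 => j _; apply: sqr_ge0.
rewrite -[_ <= _]/(algRval _ <= algRval _) rmorphXn rmorphM rmorph_nat /=.
by rewrite !mxE.
Qed.

Definition house_le (L : fieldExtType rat) (B : nat) (x : L) : Prop :=
  forall sigma : {rmorphism L -> algC}, `|sigma x| <= B%:R.

Lemma ring_of_integers_int (L : fieldExtType rat) (c : int) :
  ring_of_integers L c%:~R.
Proof. exact: (integral_id (intr : {rmorphism int -> L})). Qed.

Lemma integral_lin_comb (L : fieldExtType rat) m n (v : 'rV[L]_m)
    (U : 'M[int]_(m, n)) :
  (forall i, ring_of_integers L (v 0 i)) ->
  forall i, ring_of_integers L ((v *m map_mx intr U) 0 i).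
Proof.
move=> vO i; rewrite mxE; elim/big_ind: _ => [|x y|j _].
- exact: integral0.
- exact: integral_add.
by rewrite mxE; apply: integral_mul; [apply: vO | apply: ring_of_integers_int].
Qed.

(** The predicate [P] stands for membership in a subring containing all integers
    of house at most [C]. The constant [4 * N + 4] is large enough for
    [N * (2 * B + 1) <= (B - 1) ^ 2] to hold whenever [B] exceeds it. *)
Lemma integers_from_small_house (r : nat) : exists C : nat,
  forall (L : fieldExtType rat) (a : 'M[int]_r) (P : L -> Prop),
    totally_real L -> positive_definite a -> universal_over a L ->
    P 1 -> (forall x y, P x -> P y -> P (x - y)) ->
    (forall x y, P x -> P y -> P (x * y)) ->
    (forall x, ring_of_integers L x -> house_le C x -> P x) ->
  forall x, ring_of_integers L x -> forall B, house_le B x -> P x.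
Proof.
have [N N0 red] := hermite_reduction r.
exists (4 * N + 4)%N => L a P Lreal apos auniv P1 PB PM PC.
pose A : 'M[int]_r := \matrix_(i, j) (a i j *+ (i <= j)%N).
have Apos (x : 'rV[int]_r) : x != 0 -> 1 <= qval A x.
  by move=> /apos; rewrite qform_eval_qval gtz0_ge1.
have [U Uu HU] := red A 1 ltr01 Apos.
have {}HU (R : realDomainType) (x : 'rV[R]_r) :
    sumsq x <= N%:R * qval A (x *m map_mx intr U).
  by have := HU R x; rewrite mul1r.
have P0 : P 0 by rewrite -(subrr 1); apply: PB.
have PN x : P x -> P (- x) by move=> Px; rewrite -sub0r; apply: PB.
have PD x y : P x -> P y -> P (x + y).
  by move=> Px Py; rewrite -[y]opprK; apply: PB => //; apply: PN.
have Pnat n : P n%:R by elim: n => // n Pn; rewrite -natr1; apply: PD.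
have Pint (z : int) : P z%:~R.
  by case: z => n; [apply: Pnat | rewrite NegzE mulrNz; apply/PN/Pnat].
have Pqval (M : 'M[int]_r) (w : 'rV[L]_r) : (forall i, P (w 0 i)) -> P (qval M w).
  move=> Pw; rewrite /qval mxE; apply: (big_ind P) => // j _.
  apply: (PM); last by rewrite mxE.
  by rewrite mxE; apply: (big_ind P) => // i _; rewrite mxE; apply: PM.
move=> x xO B; elim/ltn_ind: B x xO => B IH x xO xB.
have [BC | CB] := leqP B (4 * N + 4).
  by apply: PC => // sigma; apply: le_trans (xB sigma) _; rewrite ler_nat.
have B0 : (0 < B)%N by lia.
pose alpha := x + B.+1%:R.
have sxr (sigma : {rmorphism L -> algC}) : sigma x \is Num.real := Lreal sigma x.
have alphaO : ring_of_integers L alpha.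
  by apply: integral_add => //; apply: (ring_of_integers_int _ B.+1).
have alphapos : totally_positive alpha.
  move=> sigma _; rewrite rmorphD rmorph_nat -natr1 addrA ltr_pwDr // -lerBlDr sub0r.
  exact: real_lerNnormlW.
have [v [vO vE]] := auniv alpha alphaO alphapos.
pose w : 'rV[L]_r := v *m map_mx intr (invmx U).
have wO := integral_lin_comb (invmx U) vO; rewrite -/w in wO.
have wv : w *m map_mx intr U = v by rewrite /w -mulmxA -map_mxM mulVmx // map_mx1 mulmx1.
have aw : alpha = qval A (w *m map_mx intr U) by rewrite wv -vE qform_eval_qval.
have wB i : house_le B.-1 (w 0 i).
  move=> sigma.
  have wr j : (map_mx sigma w) 0 j \is Num.real by rewrite mxE; apply: Lreal.
  have := reduced_coord_le HU wr i.
  rewrite -(map_mx_intr_rmorph sigma) -map_mxM -qval_rmorph -aw mxE => wi.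
  have aB : sigma alpha <= (B + B.+1)%:R.
    by rewrite rmorphD rmorph_nat natrD lerD2r real_ler_normlW.
  rewrite -(ler_pXn2r (isT : (0 < 2)%N)) ?nnegrE ?ler0n // (real_normK (Lreal sigma _)).
  apply: le_trans wi _; apply: le_trans (ler_wpM2l (ler0n _ _) aB) _.
  rewrite -natrX -natrM ler_nat.
  by have : (4 * N + 4 <= B.-1)%N; [lia | move: (B.-1) (prednK B0) => b; nia].
have Pw i : P (w 0 i).
  by apply: IH (wO i) (wB i); rewrite prednK //; lia.
have Palpha : P alpha by rewrite aw qval_mul; apply: Pqval.
by have := PB _ _ Palpha (Pnat B.+1); rewrite addrK.
Qed.

(** All conjugates are among the roots of one monic integral polynomial. *)
Lemma integral_house_bounded (L : fieldExtType rat) (x : L) :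
  ring_of_integers L x -> exists B, house_le B x.
Proof.
move=> [p pmon px].
pose pC : {poly algC} := map_poly intr p.
have [rs pE] := closed_field_poly_normal pC.
have pC0 : pC != 0 by rewrite map_poly_eq0_id0 ?monic_neq0 // (monicP pmon) oner_eq0.
exists (Num.bound (\sum_(z <- rs) `|z|)) => sigma.
have : root pC (sigma x).
  have -> : pC = map_poly sigma (map_poly intr p).
    by rewrite -map_poly_comp; apply: eq_map_poly => c; rewrite /= rmorph_int.
  by rewrite fmorph_root.
rewrite pE rootZ ?lead_coef_eq0 // root_prod_XsubC => xrs.
have S0 : 0 <= \sum_(z <- rs) `|z| :> algC by apply: sumr_ge0.
have := archi_boundP S0; move/ltW; apply: le_trans.
rewrite (big_rem _ xrs) /= lerDl; exact: sumr_ge0.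
Qed.

(** * The field of fractions of the ring of integers *)

Lemma rat_annihilator (L : fieldExtType rat) (x : L) :
  exists p : {poly rat}, [/\ p \is monic, (size p <= (\dim {:L}).+1)%N &
    root (map_poly (in_alg L) p) x].
Proof.
have /polyOver1P[p pE] := minPolyOver 1 x.
exists p; split.
- by have := monic_minPoly 1 x; rewrite pE map_monic.
- rewrite -(size_map_poly (in_alg L) p) -pE size_minPoly ltnS adjoin_degreeE.
  by rewrite dimv1 divn1 dimvS // subvf.
by rewrite -pE root_minPoly.
Qed.

(** If [q] is an integral polynomial of degree [n] and leading coefficient [c]
    that vanishes at [x], then [c * x] is a root of the monic polynomial
    [c ^+ n.-1 * q ('X / c)], whose coefficients are integral. *)
Lemma integral_multiple (L : fieldExtType rat) (x : L) :
  exists c : int, c%:~R != 0 :> L /\ ring_of_integers L (c%:~R * x).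
Proof.
have [p [pmon _ px]] := rat_annihilator x.
have [q [a a0 pq]] := rat_poly_scale p.
have inj_int : injective (intr : int -> L).
  move=> u v uv; apply: (@intr_inj rat); apply: (fmorph_inj (in_alg L)).
  by rewrite !rmorph_int.
have int0 (c : int) : (c%:~R == 0 :> L) = (c == 0).
  by rewrite -(inj_eq inj_int) /=.
have q0 : q != 0.
  by apply: contraTneq pmon => q0; rewrite pq q0 rmorph0 scaler0 monicE
    lead_coef0 eq_sym oner_eq0.
have qx : root (map_poly intr q) x.
  move: px; rewrite pq map_polyZ rootZ; last by rewrite fmorph_eq0 invr_eq0 intr_eq0.
  rewrite -map_poly_comp; congr (root _ x); apply: eq_map_poly => c.
  exact: (rmorph_int (in_alg L)).
pose c := lead_coef q; have c0 : c != 0 by rewrite lead_coef_eq0.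
exists c; rewrite int0; split=> //.
pose n := (size q).-1.
pose s : {poly int} := \poly_(i < n.+1) (if i == n then 1 else q`_i * c ^+ (n.-1 - i)).
have sn : s`_n = 1 by rewrite coef_poly ltnSn eqxx.
exists s.
  have ss : size s = n.+1.
    by apply: size_poly_eq; rewrite eqxx oner_eq0.
  by rewrite monicE lead_coefE ss sn.
apply/rootP; apply: (mulfI (_ : c%:~R != 0)); first by rewrite int0.
rewrite mulr0.
transitivity ((c ^+ n)%:~R * (map_poly (intr : int -> L) q).[x]); last first.
  by rewrite (rootP qx) mulr0.
have sq : size q = n.+1 by rewrite /n prednK // size_poly_gt0.
rewrite (@horner_coef_wide _ n.+1); last first.
  by rewrite (size_map_inj_poly inj_int) ?size_poly.
rewrite (@horner_coef_wide _ n.+1 (map_poly _ q)); last first.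
  by rewrite (size_map_inj_poly inj_int) ?sq.
rewrite !mulr_sumr; apply: eq_bigr => i _.
rewrite !coef_map /= coef_poly ltn_ord exprMn.
case: eqVneq => [->|ni].
  by rewrite /c lead_coefE -/n rmorphXn; ring.
have -> : c ^+ n = c * c ^+ (n.-1 - i) * c ^+ i.
  have := ltn_ord i; rewrite ltnS leq_eqVlt (negPf ni) /= => lin.
  by rewrite -mulrA -exprD -exprS; congr (_ ^+ _); lia.
by rewrite !rmorphM !rmorphXn /=; ring.
Qed.

(** * Northcott's theorem *)

(** Inside a splitting field [Q] of the minimal polynomial, the isomorphism from
    the field of [w] to that of [w'] extends to an automorphism of [Q], and this
    one extends to [algC]. Composed with an embedding of a number field, these
    automorphisms show that all conjugates of an element are values of
    embeddings. *)
Lemma conjugate_aut (z z' : algC) : root (minCpoly z) z' ->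
  exists nu : {rmorphism algC -> algC}, nu z = z'.
Proof.
move=> zz'; have [p [Dp pmon] pmin] := minCpolyP z.
have [rs pE] := closed_field_poly_normal (minCpoly z).
rewrite (monicP (minCpoly_monic z)) scale1r in pE.
have [Q [QC [rr Drr genQ]]] := num_field_exists rs.
have inQ y : root (minCpoly z) y -> exists2 yy, yy \in rr & QC yy = y.
  by rewrite pE root_prod_XsubC -Drr => /mapP[yy yyr ->]; exists yy.
have [w _ Dw] := inQ _ (root_minCpoly z); have [w' _ Dw'] := inQ _ zz'.
have QCin q : map_poly QC (map_poly (in_alg Q) q) = map_poly ratr q.
  rewrite -map_poly_comp; apply: eq_map_poly => c.
  by rewrite /= alg_num_field fmorph_rat.
pose pQ := map_poly (in_alg Q) p.
have pQ1 : pQ \is a polyOver 1%VS by apply/polyOver1P; exists p.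
have splitQ : splittingFieldFor 1 pQ fullv.
  exists rr => //; suff -> : pQ = \prod_(y <- rr) ('X - y%:P) by apply: eqpxx.
  apply: (map_poly_inj QC); rewrite QCin -Dp pE -Drr big_map rmorph_prod.
  by apply: eq_bigr => y _; rewrite /= map_polyXsubC.
have w'root : root (map_poly \1%VF (minPoly 1 w)) w'.
  have -> : map_poly \1%VF (minPoly 1 w) = minPoly 1 w.
    by apply: map_poly_id => y _; rewrite id_lfunE.
  have /polyOver1P[q qE] := minPolyOver 1 w.
  rewrite -(fmorph_root QC) Dw' qE QCin.
  have : root (map_poly ratr q) z by rewrite -QCin -Dw fmorph_root -qE root_minPoly.
  by rewrite pmin => /dvdpP[s ->]; rewrite rmorphM rootM /= -Dp zz' orbT.
have hom1 : kHom 1 1 (\1%VF : 'End(Q)) by rewrite kHom1.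
have homw := kHomExtendP (subvv 1) hom1 w'root.
have splitQw : splittingFieldFor <<1; w>> pQ fullv.
  exact: splittingFieldForS (subv_adjoin 1 w) (subvf _) splitQ.
have [g homg gE] := kHom_extends (sub1v _) homw pQ1 splitQw.
pose gM := GRing.isMonoidMorphism.Build _ _ g (kHom_monoid_morphism homg).
pose gR : {rmorphism Q -> Q} := HB.pack (fun_of_lfun g) gM.
have [nu nuE] := extend_algC_subfield_aut QC gR.
exists nu; rewrite -Dw -nuE -Dw'; congr (QC _).
by rewrite /= -gE ?memv_adjoin // (kHomExtend_val hom1 w'root).
Qed.

Lemma coef_prod_XsubC_le (C : nat) (rs : seq algC) :
    (forall z, z \in rs -> `|z| <= C%:R) ->
  forall i, `|(\prod_(z <- rs) ('X - z%:P))`_i| <= ((1 + C) ^ size rs)%:R.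
Proof.
elim: rs => [|z rs IH] zC i.
  by rewrite big_nil coef1 normr_nat ler_nat; case: (i == 0)%N.
have {}IH := IH (fun y yrs => zC y (@mem_behead _ (z :: rs) y yrs)).
have zC0 : `|z| <= C%:R by apply: zC; rewrite mem_head.
rewrite big_cons mulrBl coefB coefXM coefCM /= expnS natrM natrD mulrDl mul1r.
apply: le_trans (ler_normB _ _) _; apply: lerD; last by rewrite normrM ler_pM.
by case: eqP => _; rewrite ?normr0 ?ler0n.
Qed.

(** The coefficients of the minimal polynomial are integers, and they are bounded
    because they are symmetric functions of at most [d] roots that are bounded
    by [C]. This leaves finitely many polynomials, each with finitely many
    roots. *)
Lemma northcott (d C : nat) :
  finite_set [set z : algC | [/\ z \in Aint, (size (minCpoly z) <= d.+1)%N &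
    forall z', root (minCpoly z) z' -> `|z'| <= C%:R]].
Proof.
pose M := ((1 + C) ^ d)%N.
(* Polynomials with coefficients in the interval from - M to M, listed by their
   coefficients shifted by M. *)
pose pol (f : {ffun 'I_d.+1 -> 'I_(2 * M).+1}) : {poly algC} :=
  \poly_(i < d.+1) ((f (inord i))%:R - M%:R).
apply: (@sub_finite_set _ _
    (\bigcup_(f in [set f | pol f != 0]) [set z | root (pol f) z])); last first.
  apply: bigcup_finite => [|f /= f0]; first exact: finite_finset.
  have [rs fE] := closed_field_poly_normal (pol f).
  apply: sub_finite_set (finite_seq rs) => z /=.
  by rewrite fE rootZ ?lead_coef_eq0 // root_prod_XsubC.
move=> z [zint zsize zC].
have [rs zE] := closed_field_poly_normal (minCpoly z).
rewrite (monicP (minCpoly_monic z)) scale1r in zE.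
have rsC y : y \in rs -> `|y| <= C%:R by move=> yrs; apply: zC; rewrite zE root_prod_XsubC.
have rsd : (size rs <= d)%N by rewrite zE size_prod_XsubC ltnS in zsize.
have coefM i : `|(minCpoly z)`_i| <= M%:R.
  rewrite zE (le_trans (coef_prod_XsubC_le rsC i)) // ler_nat.
  by rewrite leq_pexp2l.
have coefE i : exists k : 'I_(2 * M).+1, k%:R - M%:R = (minCpoly z)`_i.
  have /intrP[c cE] : (minCpoly z)`_i \in Num.int by apply/polyOverP: zint i.
  have := coefM i; rewrite cE -intr_norm => cM.
  have {}cM : `|c| <= M%:Z by rewrite -(ler_int algC).
  have kM : (`|(c + M%:Z)%R|%N < (2 * M).+1)%N by lia.
  exists (Ordinal kM) => /=.
  have -> : (`|(c + M%:Z)%R|%N)%:R = (c + M%:Z)%:~R :> algC.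
    by rewrite -[LHS]/((`|(c + M%:Z)%R|%N)%:Z%:~R) gez0_abs //; lia.
  by rewrite intrD addrK.
have [k kE] := choice coefE.
have polE : pol [ffun i : 'I_d.+1 => k i] = minCpoly z.
  apply/polyP => i; rewrite coef_poly; case: ltnP => di.
    by rewrite ffunE inordK // kE.
  by rewrite nth_default // (leq_trans zsize).
exists [ffun i : 'I_d.+1 => k i] => /=; rewrite polE ?root_minCpoly //.
exact/monic_neq0/minCpoly_monic.
Qed.

(** * Finiteness *)

Lemma finite_subsets (T : choiceType) (A : set T) :
  finite_set A -> finite_set [set B : set T | B `<=` A].
Proof.
move=> /finite_seqP[s ->].
pose sub (m : (size s).-tuple bool) : set T := [set` mask m s].
apply: sub_finite_set (finite_image sub (@finite_finset _ setT)) => B Bs /=.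
exists (map_tuple (fun x => `[< B x >]) (in_tuple s)) => //.
apply/seteqP; split=> [x | x Bx]; rewrite /sub /= -filter_mask mem_filter.
  by case/andP=> /asboolP.
by rewrite (Bs x Bx) andbT; apply/asboolP.
Qed.

Definition generated_subfield (A : set algC) : set algC :=
  [set z | forall S : set algC, S 1 ->
    (forall x y, S x -> S y -> S (x - y)) ->
    (forall x y, S x -> S y -> S (x * y)) ->
    (forall x, S x -> S x^-1) -> A `<=` S -> S z].

(** This puts the generators of the field within reach of [northcott]. *)
Lemma small_house_image (L : fieldExtType rat) (iota : {rmorphism L -> algC})
    (C : nat) (x : L) : ring_of_integers L x -> house_le C x ->
  [/\ iota x \in Aint, (size (minCpoly (iota x)) <= (\dim {:L}).+1)%N &
    forall z', root (minCpoly (iota x)) z' -> `|z'| <= C%:R].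
Proof.
move=> [q qmon qx] xC; split.
- apply: (@root_monic_Aint (map_poly intr q)); last first.
  + by apply/polyOverP => i; rewrite coef_map /= intr_int.
  + by rewrite monic_map.
  have -> : map_poly intr q = map_poly iota (map_poly intr q).
    by rewrite -map_poly_comp; apply: eq_map_poly => c; rewrite /= rmorph_int.
  by rewrite fmorph_root.
- have [p [pmon ps px]] := rat_annihilator x.
  have [m [-> _] mmin] := minCpolyP (iota x).
  have mp : m %| p.
    rewrite -mmin.
    have -> : map_poly ratr p = map_poly iota (map_poly (in_alg L) p).
      rewrite -map_poly_comp; apply: eq_map_poly => c.
      by rewrite /= alg_num_field fmorph_rat.
    by rewrite fmorph_root.
  by rewrite size_map_poly (leq_trans (dvdp_leq (monic_neq0 pmon) mp)).
move=> z' /conjugate_aut[nu <-].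
exact: (xC (nu \o iota)).
Qed.

Theorem corollary9 (d r : nat) (hd : (0 < d)%N) (hr : (0 < r)%N) :
  finite_set [set K : set algC |
    exists (L : fieldExtType rat) (iota : {rmorphism L -> algC}),
      [/\ K = number_subfield iota,
          \dim {:L} = d,
          totally_real L &
          exists a : 'M[int]_r, positive_definite a /\ universal_over a L]].
Proof.
have [C HC] := integers_from_small_house r.
apply: sub_finite_set
  (finite_image generated_subfield (finite_subsets (northcott d C))).
move=> _ [L [iota [-> Ld Lreal [a [apos auniv]]]]].
(* The field is the one generated by the image of A. *)
pose A := [set x : L | ring_of_integers L x /\ house_le C x].
exists (iota @` A).
  by move=> _ [x [xO xC] <-]; rewrite -Ld; apply: small_house_image.
apply/seteqP; split=> [z | _ [x _ <-]].
  apply; rewrite /number_subfield.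
  - by exists 1 => //; rewrite rmorph1.
  - by move=> _ _ [x _ <-] [y _ <-]; exists (x - y) => //; rewrite rmorphB.
  - by move=> _ _ [x _ <-] [y _ <-]; exists (x * y) => //; rewrite rmorphM.
  - by move=> _ [x _ <-]; exists x^-1 => //; rewrite fmorphV.
  by move=> _ [x _ <-]; exists x.
move=> S S1 SB SM SV AS.
have SO y : ring_of_integers L y -> S (iota y).
  move=> yO; have [B yB] := integral_house_bounded yO.
  apply: (HC L a (fun y => S (iota y)) Lreal apos auniv _ _ _ _ y yO B yB).
  - by rewrite rmorph1.
  - by move=> u v Su Sv; rewrite rmorphB; apply: SB.
  - by move=> u v Su Sv; rewrite rmorphM; apply: SM.
  by move=> u uO uC; apply: AS; exists u.
have [c [c0 cx]] := integral_multiple x.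
have -> : x = c%:~R^-1 * (c%:~R * x) by rewrite mulKf.
by rewrite rmorphM fmorphV; apply: SM; [apply/SV/SO/ring_of_integers_int | apply: SO].
Qed.
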